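(* Let $k\geq 2$, let $\mathbb F_q$ be the finite field with $q$ elements, let $\beta\in\mathbb Z_{\geq 0}^k$, and let $V_1,\ldots,V_k$ be vector spaces over $\mathbb F_q$ with $\dim V_i=\beta_i$. Let $Z\subseteq\prod_{i=1}^kV_i$ be the set of tuples $(v_1,\ldots,v_k)$ for which some $v_i=0$. The probability that a representation in $\mathrm{Rep}(Q,\beta)$ is nilpotent is $$\mathrm{Prob}(\mathcal N(\beta))=\frac{|Z|}{\prod_{i=1}^k|V_i|}=1-\prod_{i=1}^k(1-q^{-\beta_i}).$$
   Context: Indices are taken modulo $k$. $Q$ is the cyclic quiver $1\to 2\to\cdots\to k\to 1$ and $\mathrm{Rep}(Q,\beta)=\prod_{i=1}^k\mathrm{Hom}_{\mathbb F_q}(V_i,V_{i+1})$. A representation $f=(f_1,\ldots,f_k)\in\mathrm{Rep}(Q,\beta)$ is nilpotent if for each $1\leq i\leq k$ and all sufficiently large $\ell$ the composition $f_{i+\ell-1}\circ\cdots\circ f_i$ is zero; $\mathcal N(\beta)$ is the set of nilpotent representations. Probability is with respect to the uniform distribution: $\mathrm{Prob}(\mathcal N(\beta))=|\mathcal N(\beta)|/|\mathrm{Rep}(Q,\beta)|$. *)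

(* Defs.v *)
From HB Require Import structures.
From mathcomp Require Import all_boot all_order all_algebra all_field.
From mathcomp Require Import boolp.

Set Implicit Arguments.
Unset Strict Implicit.
Unset Printing Implicit Defensive.

Import GRing.Theory Num.Theory.
Local Open Scope ring_scope.

(* The vertices of the cyclic quiver are 'I_k, and its arrows are the         *)
(* i -> ordS i, where ordS i is i + 1 modulo k. [finvect_type U] is U itself, *)
(* seen as a finite type when the base field is finite.                       *)

Section CyclicQuiver.
Variables (F : finFieldType) (k : nat) (V : 'I_k -> vectType F).

Definition tuples : finType := {dffun forall i : 'I_k, finvect_type (V i)}.

Definition Rep : finType :=
  {dffun forall i : 'I_k, finvect_type 'Hom(V i, V (ordS i))}.

Definition arrow (f : Rep) (i : 'I_k) : 'Hom(V i, V (ordS i)) := f i.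

(* f_{i+l-1} \o ... \o f_i *)
Fixpoint path_comp (f : Rep) (i : 'I_k) (l : nat) :
    'Hom(V i, V (iter l (@ordS k) i)) :=
  if l is m.+1 then (arrow f (iter m (@ordS k) i) \o path_comp f i m)%VF
  else \1%VF.

Definition nilpotent_rep (f : Rep) : Prop :=
  forall i : 'I_k, exists L : nat, forall l : nat, (L <= l)%N ->
    path_comp f i l = 0.

Definition nilpotent_reps : {set Rep} := [set f : Rep | `[< nilpotent_rep f >]].

Definition zero_tuples : {set tuples} :=
  [set v : tuples | [exists i, (v i : V i) == 0]].

End CyclicQuiver.

Definition Prob (T : finType) (A : {set T}) : rat := #|A|%:R / #|T|%:R.

(* Main.v *)
(* Fix a vertex i, let B be the composite of all arrows but f_i along the cycle
   from V_{i+1} to V_i, and note that f is nilpotent iff f_i B is. For fixed B and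
   uniform f_i this has probability q^(- rank B): up to a change of bases only an
   r x r block of f_i matters, r = rank B, and a uniform r x r matrix is nilpotent
   with probability q^-r (Fine-Herstein). Now q^(- rank B) is the probability that
   B x = 0 for a uniform x in V_{i+1}, and along the cycle a nonzero vector is
   mapped to a uniform one, so that B x <> 0 with probability
   prod_i (1 - q^(- beta_i)).
   For the Fine-Herstein count, sort the pairs (A, v) with A nilpotent and v <> 0 by
   the largest j such that v, vA, .., vA^j are nonzero. These vectors are then
   independent, and once they are fixed A is determined up to a nilpotent matrix
   of size n-j-1 and an arbitrary off-diagonal block, which gives a recursion. *)
Require Import Defs.
From HB Require Import structures.
From mathcomp Require Import all_boot all_order all_algebra all_field.
From mathcomp Require Import boolp zify.

Set Implicit Arguments.
Unset Strict Implicit.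
Unset Printing Implicit Defensive.

Import GRing.Theory Num.Theory.
Import VectorInternalTheory.
Local Open Scope ring_scope.

(** * Nilpotent matrices and Krylov sequences *)

Definition nilpmx (F : fieldType) n (A : 'M[F]_n) : bool :=
  `[< exists l, A ^+ l = 0 >].

Section NilpotentMatrices.
Variable F : fieldType.

Lemma nilpmxP n (A : 'M[F]_n) : reflect (exists l, A ^+ l = 0) (nilpmx A).
Proof. exact: asboolP. Qed.

Lemma mulmx_exprD n (A : 'M[F]_n) a b : A ^+ a *m A ^+ b = A ^+ (a + b).
Proof. by rewrite exprD. Qed.

Lemma mulmx_exprSr n (A : 'M[F]_n) a : A ^+ a *m A = A ^+ a.+1.
Proof. by rewrite exprSr. Qed.

(** This rests on (DC)^(l+1) = D (CD)^l C. The factors may be rectangular, so the two products may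
    have different sizes. *)
Lemma nilpmx_mulC m n (A : 'M[F]_(m, n)) (B : 'M_(n, m)) :
  nilpmx (A *m B) = nilpmx (B *m A).
Proof.
suff imp a b (C : 'M[F]_(a, b)) (D : 'M_(b, a)) :
    nilpmx (C *m D) -> nilpmx (D *m C) by apply/idP/idP; apply: imp.
move=> /nilpmxP[l CDl]; apply/nilpmxP; exists l.+1.
have -> : (D *m C) ^+ l.+1 = D *m (C *m D) ^+ l *m C.
  elim: l {CDl} => [|l IHl]; first by rewrite mulmx1 expr1.
  rewrite exprS IHl [in RHS]exprS.
  by rewrite -[_ * (_ : 'M_b)]/(_ *m _) -[_ * (_ : 'M_a)]/(_ *m _) !mulmxA.
by rewrite CDl mulmx0 mul0mx.
Qed.

Lemma nilpmx_conj n (P A : 'M[F]_n) :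
  P \in unitmx -> nilpmx (P *m A *m invmx P) = nilpmx A.
Proof. by move=> Pu; rewrite nilpmx_mulC mulKmx. Qed.

Lemma expr_lblock_mx m n (A : 'M[F]_m) (C : 'M_(n, m)) (D : 'M_n) l :
  exists C', block_mx A 0 C D ^+ l = block_mx (A ^+ l) 0 C' (D ^+ l).
Proof.
elim: l => [|l [C' IHl]]; first by exists 0; rewrite !expr0 -scalar_mx_block.
exists (C *m A ^+ l + D *m C').
rewrite !exprS IHl -[_ * (_ : 'M_(_ + _))]/(_ *m _) mulmx_block.
by rewrite !(mul0mx, mulmx0, addr0, add0r).
Qed.

Lemma nilpmx_lblock m n (A : 'M[F]_m) (C : 'M_(n, m)) (D : 'M_n) :
  nilpmx (block_mx A 0 C D) = nilpmx A && nilpmx D.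
Proof.
apply/nilpmxP/andP => [[l M0]|[/nilpmxP[a A0] /nilpmxP[d D0]]].
  have [C'] := expr_lblock_mx A C D l; rewrite M0 -block_mx0.
  by case/eq_block_mx=> A0 _ _ D0; split; apply/nilpmxP; exists l.
have [C'] := expr_lblock_mx A C D (a + d).
rewrite !exprD A0 D0 mul0r mulr0 -exprD => M0.
(* The power a + d kills both diagonal blocks; what remains is strictly block triangular, hence
   squares to zero. *)
exists ((a + d) + (a + d))%N.
rewrite exprD M0 -[_ * (_ : 'M_(_ + _))]/(_ *m _) mulmx_block.
by rewrite !(mul0mx, mulmx0, addr0) block_mx0.
Qed.

(** The nilpotent Jordan block: from the left, it moves rows up by one and clears the last. *)
Definition shift_mx n : 'M[F]_n := \matrix_(i, j) (j == i.+1 :> nat)%:R.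

Lemma nilpmx_shift n : nilpmx (shift_mx n).
Proof.
apply/nilpmxP; exists n.
suff Sl l i j : (shift_mx n ^+ l) i j = (j == (i + l)%N :> nat)%:R.
  by apply/matrixP=> i j; rewrite Sl mxE ltn_eqF // ltn_addl.
elim: l i => [|l IHl] i; first by rewrite mxE addn0 eq_sym.
rewrite exprS mxE; have [lt_i|ge_i] := ltnP i.+1 n.
  rewrite (bigD1 (Ordinal lt_i)) //= mxE eqxx mul1r IHl big1 ?addr0 ?addSnnS //.
  by move=> k /negPf nk; rewrite mxE -[_ == _ :> nat]/(k == Ordinal lt_i) nk mul0r.
rewrite big1 => [|k _]; last first.
  by rewrite mxE ltn_eqF ?mul0r // (leq_trans (ltn_ord k)).
by rewrite ltn_eqF // -addSnnS (leq_trans (ltn_ord j)) // (leq_trans ge_i) ?leq_addr.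
Qed.

Lemma row_shift_mul n p (K : 'M[F]_(n, p)) i :
  row i (shift_mx n *m K) = if insub i.+1 is Some j then row j K else 0.
Proof.
apply/rowP=> c; rewrite !mxE; case: insubP => [j _ ji|]; last first.
  rewrite -leqNgt => ge_i; rewrite big1 ?mxE // => k _.
  by rewrite mxE ltn_eqF ?mul0r // (leq_trans (ltn_ord k)).
rewrite (bigD1 j) //= !mxE ji eqxx mul1r big1 ?addr0 // => k /negPf nk.
by rewrite mxE -ji -[_ == _ :> nat]/(k == j) nk mul0r.
Qed.

Definition krylov_mx n (A : 'M[F]_n) (v : 'rV_n) j : 'M_(j, n) :=
  \matrix_(i < j) (v *m A ^+ i).

Lemma krylov_free n (A : 'M[F]_n) v j :
  v *m A ^+ j.+1 = 0 -> v *m A ^+ j != 0 -> row_free (krylov_mx A v j.+1).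
Proof.
move=> vS0 vj; rewrite -kermx_eq0; apply/rowV0P=> x /sub_kermxP x0.
have v0 a : (j < a)%N -> v *m A ^+ a = 0.
  by move=> /subnK <-; rewrite addnC exprD mulmxA vS0 mul0mx.
suff xt t : (t <= j.+1)%N -> forall i : 'I_j.+1, (i < t)%N -> x 0 i = 0.
  by apply/rowP=> i; rewrite mxE (xt j.+1).
elim: t => // t IHt lt_t i; rewrite ltnS leq_eqVlt => /predU1P[it|/IHt]; last first.
  by apply; apply: ltnW.
(* Coefficients before t vanish by induction, and A^(j-t) kills the terms after t, so only x_t v A^j
   survives. *)
have : x *m krylov_mx A v j.+1 *m A ^+ (j - t) = 0 by rewrite x0 mul0mx.
rewrite [x *m _]mulmx_sum_row mulmx_suml (bigD1 i) //= big1 => [|k nk].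
  rewrite rowK -scalemxAl -mulmxA mulmx_exprD it.
  rewrite addr0 subnKC // => /eqP; rewrite scaler_eq0 (negPf vj) orbF.
  by move/eqP.
rewrite rowK -scalemxAl -mulmxA mulmx_exprD.
case: (ltngtP k t) => [lt_kt|gt_kt|kt];
  first by rewrite (IHt (ltnW lt_t) k lt_kt) scale0r.
  have lt_j : (j < k + (j - t))%N by clear -lt_t gt_kt; lia.
  by rewrite (v0 _ lt_j) scaler0.
by case/eqP: nk; apply: val_inj; rewrite /= kt it.
Qed.

Lemma mul_krylov n (A : 'M[F]_n) v j :
  v *m A ^+ j = 0 -> krylov_mx A v j *m A = shift_mx j *m krylov_mx A v j.
Proof.
move=> vj; apply/row_matrixP=> i; rewrite row_shift_mul row_mul rowK.
rewrite -mulmxA mulmx_exprSr.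
case: insubP => [k _ ki|]; first by rewrite rowK ki.
by rewrite -leqNgt => /subnK <-; rewrite addnC exprD mulmxA vj mul0mx.
Qed.

(** Read row by row, the equation says that A sends each row of K to the next one and the last row
    to 0. This is the converse of [mul_krylov]. *)
Lemma krylov_of_mul n (A : 'M[F]_n) j (K : 'M_(j.+1, n)) :
  K *m A = shift_mx j.+1 *m K ->
  K = krylov_mx A (row 0 K) j.+1 /\ row 0 K *m A ^+ j.+1 = 0.
Proof.
move=> KA; have rowA i : row i K *m A = if insub i.+1 is Some k then row k K else 0.
  by rewrite -row_mul KA row_shift_mul.
have rowK' i (lt_i : (i < j.+1)%N) : row 0 K *m A ^+ i = row (Ordinal lt_i) K.
  elim: i lt_i => [|i IHi] lt_i; first by rewrite mulmx1; congr row; apply: val_inj.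
  rewrite -mulmx_exprSr mulmxA (IHi (ltnW lt_i)) rowA insubT.
  by congr row; apply: val_inj.
split; first by apply/row_matrixP=> i; rewrite rowK rowK'; congr row; apply: val_inj.
by rewrite -mulmx_exprSr mulmxA rowK' rowA insubF // ltnn.
Qed.

End NilpotentMatrices.

(** * Counting nilpotent matrices over a finite field *)

Section Counting.
Variable F : finFieldType.
Local Notation q := #|F|.

Definition nilpmx_set n : {set 'M[F]_n} := [set A | nilpmx A].

Lemma card_field_gt1 : (1 < q)%N.
Proof. exact: finNzRing_gt1. Qed.

Lemma row_free_complete j p (K : 'M[F]_(j, j + p)) :
  row_free K -> exists2 P, P \in unitmx & row_mx 1%:M 0 *m P = K.
Proof.
move=> freeK; pose U : 'M[F]_(j, j + p) := row_mx 1%:M 0.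
have UK : U *m col_mx K 0 = K by rewrite mul_row_col mul1mx mul0mx addr0.
have [] := @complete_unitmx _ _ _ U (col_mx K 0).
  rewrite UK (eqP freeK) /U; symmetry; apply/eqP/row_freeP.
  by exists (col_mx 1%:M 0); rewrite mul_row_col mul1mx mul0mx addr0.
by move=> P Pu UP; exists P => //; rewrite -UP.
Qed.

Lemma row_free_colv j n (v : 'rV[F]_n) (K : 'M_(j, n)) :
  row_free (col_mx v K) = row_free K && ~~ (v <= K)%MS.
Proof.
case: (boolP (row_free K)) => [freeK|/negP notK] /=; last first.
  apply/negP=> /row_freeP[B]; rewrite mul_col_mx -[B]hsubmxK !mul_mx_row.
  rewrite scalar_mx_block => /eq_block_mx[_ _ _ KB].
  by apply: notK; apply/row_freeP; exists (rsubmx B).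
(* By the dimension formula it remains to compare the ranks of [v :&: K] and [v]; this also covers v
   = 0. *)
rewrite /row_free eqn_leq rank_leq_row /= -(leq_add2r (\rank (v :&: K)%MS)).
rewrite -addsmxE mxrank_sum_cap (eqnP freeK) addnAC leq_add2r.
by rewrite (ltn_leqif (mxrank_leqif_sup _)) ?capmxSl // sub_capmx submx_refl.
Qed.

(** In a basis that starts with the rows of K, the equation forces the first j rows of A to be
    (shift, 0). The lower right p x p block must then be nilpotent, and the lower left block is
    free. *)
Lemma card_nilpmx_intertwine j p (K : 'M[F]_(j, j + p)) : row_free K ->
  #|[set A | nilpmx A & K *m A == shift_mx F j *m K]|
    = (#|nilpmx_set p| * q ^ (p * j))%N.
Proof.
case/row_free_complete=> P Pu <-.
pose f (A : 'M[F]_(j + p)) := P *m A *m invmx P.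
have fK : cancel f (fun A => invmx P *m A *m P).
  by move=> A; rewrite /f -!mulmxA mulVmx // mulmx1 mulKmx.
have gK : cancel (fun A => invmx P *m A *m P) f.
  by move=> A; rewrite /f -!mulmxA mulmxV // mulmx1 mulKVmx.
pose b (x : 'M[F]_p * 'M[F]_(p, j)) := block_mx (shift_mx F j) 0 x.2 x.1.
have b_inj : injective b.
  by move=> [D C] [D' C'] /eq_block_mx[_ _ /= -> ->].
rewrite -card_mx -cardsT -cardsX -(card_imset _ b_inj).
rewrite -[RHS](on_card_preimset (f := f));
  last by exists (fun A => invmx P *m A *m P) => A _.
apply: eq_card => A; rewrite !inE -[nilpmx A](nilpmx_conj _ Pu) -/(f A).
have -> : (row_mx 1%:M 0 *m P *m A == shift_mx F j *m (row_mx 1%:M 0 *m P))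
   = (row_mx 1%:M 0 *m f A == row_mx (shift_mx F j) 0).
  rewrite -(can_eq (mulmxKV Pu)) /f !mulmxA mulmxK //.
  by rewrite mul_mx_row mulmx1 mulmx0.
rewrite -[f A]submxK mul_row_block !mul1mx !mul0mx !addr0.
apply/andP/imsetP => [[nilA /eqP/eq_row_mx[ul ur]]|[[D C]]].
  move: nilA; rewrite ul ur nilpmx_lblock nilpmx_shift /= => nilD.
  by exists (drsubmx (f A), dlsubmx (f A)); rewrite ?inE ?nilD.
rewrite !inE andbT /b /= => nilD /eq_block_mx[-> -> -> ->].
by rewrite nilpmx_lblock nilpmx_shift nilD eqxx.
Qed.

Definition row_free_set j n : {set 'M[F]_(j, n)} := [set K | row_free K].

Lemma card_row_free0 n : #|row_free_set 0 n| = 1%N.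
Proof.
rewrite (eq_card (B := predT)) ?card_mx ?mul0n // => K.
by rewrite !inE -kermx_eq0 (flatmx0 (kermx K)) eqxx.
Qed.

(** A pair of a free K and a row v either extends K to a free matrix or has v among the q^j vectors
    of the row space of K. The additive form avoids subtraction. *)
Lemma card_row_freeS j n :
  (#|row_free_set j.+1 n| + #|row_free_set j n| * q ^ j
    = #|row_free_set j n| * q ^ n)%N.
Proof.
have card_rV m : (q ^ m = #|[set: 'rV[F]_m]|)%N by rewrite cardsT card_mx mul1n.
rewrite [in RHS]card_rV -cardsX.
rewrite -(cardsID [set x : 'M[F]_(j, n) * 'rV[F]_n | (x.2 <= x.1)%MS]) addnC.
congr (_ + _)%N.
  rewrite -sum_nat_const -sum1_card.
  rewrite (eq_bigl (fun x => (x.1 \in row_free_set j n) && (x.2 <= x.1)%MS)).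
    rewrite -(pair_big_dep (mem (row_free_set j n))
      (fun K (v : 'rV_n) => (v <= K)%MS) (fun _ _ => 1%N)) /=.
    apply: eq_bigr => K; rewrite inE => freeK; rewrite sum1dep_card.
    rewrite card_rV -(card_imset _ (row_free_inj freeK)).
    apply: eq_card => v; rewrite !inE.
    by apply/imsetP/submxP => [[x _ ->]|[x ->]]; exists x; rewrite ?inE.
  by move=> x; rewrite !inE andbT.
pose h (x : 'M[F]_(j, n) * 'rV[F]_n) : 'M_(1 + j, n) := col_mx x.2 x.1.
rewrite -[#|row_free_set j.+1 n|](on_card_preimset (f := h)); last first.
  exists (fun M : 'M_(1 + j, n) => (dsubmx M, usubmx M)) => [[K v]|M] _.
    by rewrite /h col_mxKd col_mxKu.
  by rewrite /h vsubmxK.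
apply: eq_card => -[K v]; by rewrite !inE /= andbT row_free_colv andbC.
Qed.

(** Replacing v by its Krylov matrix K turns these pairs into pairs of a free K and a nilpotent A
    that intertwines K with the shift. *)
Lemma card_nilpmx_height j p :
  #|[set x : 'M[F]_(j.+1 + p) * 'rV_(j.+1 + p) |
      [&& nilpmx x.1, x.2 *m x.1 ^+ j != 0 & x.2 *m x.1 ^+ j.+1 == 0]]|
    = (#|row_free_set j.+1 (j.+1 + p)| * (#|nilpmx_set p| * q ^ (p * j.+1)))%N.
Proof.
set E := [set x | _].
pose kry (x : 'M[F]_(j.+1 + p) * 'rV_(j.+1 + p)) := (krylov_mx x.1 x.2 j.+1, x.1).
have kry_inj : injective kry.
  move=> [A v] [B w] [/(congr1 (row 0))].
  by rewrite !rowK !mulmx1 => -> ->.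
rewrite -(card_imset E kry_inj) -sum_nat_const -sum1_card.
rewrite (eq_bigl (fun x => (x.1 \in row_free_set j.+1 (j.+1 + p)) &&
  (nilpmx x.2 && (x.1 *m x.2 == shift_mx F j.+1 *m x.1)))); last first.
  move=> [K A]; apply/imsetP/idP => [[[B v]]|].
    rewrite inE /= => /and3P[nilB vj /eqP vSj] [-> ->]; rewrite inE krylov_free //=.
    by rewrite nilB mul_krylov ?eqxx.
  rewrite inE /= => /and3P[freeK nilA /eqP KA]; have [defK vSj] := krylov_of_mul KA.
  exists (A, row 0 K); last by rewrite /kry /= -defK.
  rewrite inE /= nilA vSj eqxx andbT.
  (* The last row of K is v A^j with v = [row 0 K], and it is nonzero because K is free. *)
  have := rowK (fun i : 'I_j.+1 => row 0 K *m A ^+ i) ord_max.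
  rewrite -/(krylov_mx A (row 0 K) j.+1) -defK /= => <-.
  rewrite rowE mulmx_free_eq0 //; apply/eqP=> /matrixP/(_ 0 ord_max)/eqP.
  by rewrite !mxE !eqxx oner_eq0.
rewrite -(pair_big_dep (mem (row_free_set j.+1 (j.+1 + p)))
  (fun K A => nilpmx A && (K *m A == shift_mx F j.+1 *m K)) (fun _ _ => 1%N)) /=.
apply: eq_bigr => K; rewrite inE => freeK.
by rewrite sum1dep_card card_nilpmx_intertwine.
Qed.

(* The j-th term counts the n x n matrices whose row j is the first one to depend
   on the previous rows; j = n accounts for the invertible matrices. *)
Lemma sum_card_row_free n : (0 < n)%N ->
  (\sum_(j < n.+1) #|row_free_set j n| * q ^ ((n - j) * n.-1) = q ^ (n * n))%N.
Proof.
move=> n_gt0; rewrite big_ord_recr /= subnn mul0n muln1.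
(* The extra term counts the matrices whose first m rows are independent. *)
suff tele m : (m <= n)%N ->
    (\sum_(j < m) #|row_free_set j n| * q ^ ((n - j) * n.-1)
      + #|row_free_set m n| * q ^ ((n - m) * n) = q ^ (n * n))%N.
  by rewrite -(tele n) // subnn mul0n muln1.
elim: m => [|m IHm] lt_mn; first by rewrite big_ord0 card_row_free0 subn0 mul1n.
rewrite -(IHm (ltnW lt_mn)) big_ord_recr /= -addnA; congr (_ + _)%N.
have -> : (n - m = (n - m.+1).+1)%N by lia.
rewrite (mulSn _ n) expnD mulnA -card_row_freeS mulnDl -mulnA -expnD addnC.
congr (_ + _ * q ^ _)%N; nia.
Qed.

Lemma card_nilpmx n : #|nilpmx_set n| = (q ^ (n * n.-1))%N.
Proof.
elim/ltn_ind: n => n IHn; case: (posnP n) => [->|n_gt0].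
  rewrite (eq_card (B := predT)) ?card_mx // => A.
  by rewrite !inE; apply/nilpmxP; exists 0%N; apply: flatmx0.
pose height (x : 'M[F]_n * 'rV_n) i :=
  [&& nilpmx x.1, x.2 *m x.1 ^+ i != 0 & x.2 *m x.1 ^+ i.+1 == 0].
have height_gt x i l : height x i -> (i < l)%N -> x.2 *m x.1 ^+ l = 0.
  case/and3P=> _ _ /eqP x0 /subnK <-.
  by rewrite addnC -mulmx_exprD mulmxA x0 mul0mx.
(* For A nilpotent and v nonzero exactly one height occurs: one less than the least exponent killing
   v. It is below n because i + 1 independent Krylov vectors fit in dimension n. *)
have sum_height x : (\sum_(i < n) height x i = (nilpmx x.1 && (x.2 != 0%R)))%N.
  have [/= /andP[nilA v0]|] := boolP (_ && _); last first.
    rewrite negb_and negbK => v0; apply: big1 => i _.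
    rewrite /height; case/orP: v0 => [/negPf -> //|/eqP ->].
    by rewrite mul0mx eqxx andbF.
  have : exists l, x.2 *m x.1 ^+ l == 0.
    by case/nilpmxP: nilA => l A0; exists l; rewrite A0 mulmx0.
  case/ex_minnP=> -[|i] vi min_i; first by rewrite mulmx1 (negPf v0) in vi.
  have hi : height x i.
    by rewrite /height nilA vi andbT; apply/negP=> /min_i; rewrite ltnn.
  have lt_in : (i < n)%N.
    have /and3P[_ ? /eqP ?] := hi; have /eqP <- : row_free (krylov_mx x.1 x.2 i.+1).
      exact: krylov_free.
    exact: rank_leq_col.
  rewrite (bigD1 (Ordinal lt_in)) //= hi big1 ?addn0 // => k nk.
  apply/eqP; rewrite eqb0; apply/negP => hk.
  have /and3P[_ /eqP vk _] := hk; have /and3P[_ /eqP vi' _] := hi.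
  case: (ltngtP k i) => [/(height_gt _ _ _ hk)//|/(height_gt _ _ _ hi)//|ki].
  by case/eqP: nk; apply: val_inj.
have card_height i : (i < n)%N ->
    #|[set x | height x i]| = (#|row_free_set i.+1 n| * q ^ ((n - i.+1) * n.-1))%N.
  move=> lt_in; have [p def_n] : exists p, n = (i.+1 + p)%N.
    by exists (n - i.+1)%N; rewrite subnKC.
  move: (IHn p); rewrite /height; move: n_gt0 lt_in {IHn height height_gt sum_height}.
  rewrite def_n => _ _ IHp.
  rewrite card_nilpmx_height IHp; last by lia.
  rewrite -expnD; congr (_ * q ^ _)%N; nia.
(* The term j = 0 is q^(n(n-1)); the term j = i + 1 counts the pairs of height i. With N nilpotent
   matrices this reads q^(n(n-1)) + N (q^n - 1) = q^(n^2), which determines N. *)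
have := sum_card_row_free n_gt0.
rewrite big_ord_recl card_row_free0 mul1n subn0.
under eq_bigr => i _ do rewrite -card_height //.
under eq_bigr => i _ do rewrite -sum1_card big_mkcond /=.
rewrite exchange_big /=.
under eq_bigr => x _.
  under eq_bigr => i _ do rewrite inE -[if _ then _ else _]/(nat_of_bool (height x i)).
  rewrite sum_height.
  over.
rewrite -(pair_bigA _ (fun A (v : 'rV[F]_n) => (nilpmx A && (v != 0) : nat))) /=.
have count_nz : (\sum_(v : 'rV[F]_n) (v != 0%R) = (q ^ n).-1)%N.
  rewrite -[in RHS](mul1n n) -card_mx -(cardC1 (0 : 'rV[F]_n)) -sum1_card.
  rewrite [RHS]big_mkcond /=.
  by apply: eq_bigr => v _; rewrite inE /=; case: eqP.
under eq_bigr => A _.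
  rewrite (_ : (\sum_j _ = nilpmx A * (q ^ n).-1)%N); last first.
    by case: (nilpmx A) => /=; [rewrite mul1n | rewrite big1].
  over.
rewrite -big_distrl /= -big_mkcond /= sum1dep_card => eq_q.
have q1 := card_field_gt1.
have qn : (0 < (q ^ n).-1)%N by rewrite -subn1 subn_gt0 -(exp1n n) ltn_exp2r.
apply/eqP; rewrite -(eqn_pmul2r qn) -(eqn_add2l (q ^ (n * n.-1))) eq_q.
rewrite -mulnS prednK ?expn_gt0 1?ltnW //.
by rewrite -expnD; apply/eqP; congr (_ ^ _)%N; nia.
Qed.

Lemma card_nilpmx_ulsub r a b :
  #|[set h : 'M[F]_(r + b, r + a) | nilpmx (ulsubmx h)]|
    = (q ^ (r * r.-1 + r * a + b * r + b * a))%N.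
Proof.
pose f (x : 'M[F]_r * 'M[F]_(r, a) * 'M[F]_(b, r) * 'M[F]_(b, a)) :=
  block_mx x.1.1.1 x.1.1.2 x.1.2 x.2.
have f_inj : injective f.
  by move=> [[[? ?] ?] ?] [[[? ?] ?] ?] /eq_block_mx /= [-> -> -> ->].
rewrite !expnD -card_nilpmx -!card_mx -!cardsT -!cardsX -(card_imset _ f_inj).
apply: eq_card => h; rewrite inE; apply/idP/imsetP => [nil_h|[x]].
  exists (ulsubmx h, ursubmx h, dlsubmx h, drsubmx h); last by rewrite /f /= submxK.
  by rewrite !inE /= nil_h.
by rewrite !inE !andbT => nil_x ->; rewrite /f block_mxKul.
Qed.

(** Both proportions equal q^(-r) with r the rank of B: invertible changes of bases reduce B to
    [pid_mx r], and then only the r x r corner of g decides nilpotency. *)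
Lemma card_nilpmx_mul m n (B : 'M[F]_(m, n)) :
  (#|[set g : 'M_(n, m) | nilpmx (B *m g)]| * q ^ m
    = q ^ (n * m) * #|[set x : 'rV_m | x *m B == 0%R]|)%N.
Proof.
rewrite -(mulmx_ebase B); move: (col_ebase_unit B) (row_ebase_unit B).
move: (col_ebase B) (row_ebase B) (rank_leq_row B) (rank_leq_col B).
move: (\rank B) => r L R /subnKC def_m /subnKC def_n.
move: (m - r)%N (n - r)%N def_m def_n => a b def_m def_n.
case: m / def_m B L => B L; case: n / def_n B R => _ R Lu Ru.
pose h (g : 'M_(r + b, r + a)) := R *m g *m L.
have h_bij : bijective h.
  exists (fun g => invmx R *m g *m invmx L) => g; rewrite /h.
    by rewrite !mulmxA mulVmx // mul1mx mulmxK.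
  by rewrite !mulmxA mulmxV // mul1mx mulmxKV.
pose k (x : 'rV_(r + a)) := x *m L.
have k_bij : bijective k by exists (mulmx^~ (invmx L)) => x; rewrite /k ?mulmxK ?mulmxKV.
have -> : [set g | nilpmx (L *m pid_mx r *m R *m g)]
    = h @^-1: [set g | nilpmx (ulsubmx g)].
  (* Using cyclicity twice puts [pid_mx r] on the right, which clears the right-hand columns and
     makes the product block lower triangular. *)
  apply/setP=> g; rewrite !inE -!mulmxA nilpmx_mulC -!mulmxA nilpmx_mulC (mulmxA R).
  rewrite -/(h g) -[in LHS](submxK (h g)) pid_mx_block mulmx_block.
  rewrite !mulmx0 !mulmx1 !addr0 nilpmx_lblock; apply/andb_idr => _.
  by apply/nilpmxP; exists 1%N; rewrite expr1.
have -> : [set x | x *m (L *m pid_mx r *m R) == 0] = k @^-1: [set x | lsubmx x == 0].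
  apply/setP=> x; rewrite !inE !mulmxA mulmx_free_eq0 ?row_free_unit // -/(k x).
  rewrite -[in LHS](hsubmxK (k x)) pid_mx_block mul_row_block.
  rewrite !mulmx0 !mulmx1 !addr0 -row_mx0.
  by apply/eqP/eqP => [/eq_row_mx[]|->].
rewrite !on_card_preimset; try exact: onW_bij.
rewrite card_nilpmx_ulsub.
have -> : #|[set x : 'rV[F]_(r + a) | lsubmx x == 0]| = (q ^ a)%N.
  have rinj : injective (fun y : 'rV[F]_a => row_mx (0 : 'rV[F]_r) y).
    by move=> y z /eq_row_mx[].
  rewrite -[a in RHS]mul1n -card_mx -cardsT -(card_imset _ rinj).
  apply: eq_card => x; rewrite inE; apply/eqP/imsetP => [x0|[y _ ->]].
    by exists (rsubmx x); rewrite ?inE // -x0 hsubmxK.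
  by rewrite row_mxKl.
rewrite -!expnD; congr (_ ^ _)%N; nia.
Qed.

End Counting.

(** * From matrices to linear maps *)

Lemma card_set_sum (T : finType) (P : pred T) :
  #|[set x | P x]| = (\sum_x P x)%N.
Proof.
by rewrite -sum1_card big_mkcond; apply: eq_bigr => x _; rewrite inE; case: (P x).
Qed.

Section LinearMaps.
Variables (F : finFieldType) (U W : vectType F).

Definition eventually_zero (V : nmodType) (T : V -> V) : Prop :=
  exists l, forall x, iter l T x = 0.

Lemma lfun_mulmx (U' W' : vectType F) (f : 'Hom(U', W')) x : f x = r2v (v2r x *m f2mx f).
Proof. by rewrite unlock. Qed.

(** Coordinates are row vectors acted on from the right, so the matrix of g after B has B first. *)
Lemma eventually_zero_nilpmx (B : 'Hom(U, W)) (g : 'Hom(W, U)) :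
  eventually_zero (fun x => g (B x)) <-> nilpmx (f2mx B *m f2mx g).
Proof.
have iterM l x : iter l (fun y => g (B y)) x = r2v (v2r x *m (f2mx B *m f2mx g) ^+ l).
  elim: l => [|l IHl]; first by rewrite mulmx1 v2rK.
  by rewrite iterS IHl !lfun_mulmx !r2vK -!mulmxA mulmx_exprSr.
split=> [[l l0]|/nilpmxP[l l0]].
  apply/nilpmxP; exists l; apply/row_matrixP=> i; rewrite rowE row0.
  by rewrite -[delta_mx 0 i]r2vK -[LHS]r2vK -iterM l0 linear0.
by exists l => x; rewrite iterM l0 mulmx0 linear0.
Qed.

Lemma v2r_bij (V : vectType F) :
  bijective (fun x : finvect_type V => v2r (x : V) : 'rV[F]_(dim V)).
Proof. by exists (fun r => r2v r : V) => x; rewrite ?v2rK ?r2vK. Qed.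

Lemma card_finvect (V : vectType F) : #|finvect_type V| = (#|F| ^ dim V)%N.
Proof. by rewrite (bij_eq_card (v2r_bij V)) card_mx mul1n. Qed.

Lemma f2mx_bij (U' W' : vectType F) :
  bijective (f2mx : finvect_type 'Hom(U', W') -> 'M[F]_(dim U', dim W')).
Proof. by exists (fun A => Hom A) => [[A]|A]. Qed.

Lemma card_eventually_zero (B : 'Hom(U, W)) :
  (#|[set g : finvect_type 'Hom(W, U) |
        `[< eventually_zero (fun x => (g : 'Hom(W, U)) (B x)) >]]| * #|finvect_type U|
    = #|finvect_type 'Hom(W, U)| * #|[set x : finvect_type U | B x == 0%R]|)%N.
Proof.
have := card_nilpmx_mul (f2mx B); rewrite -card_finvect -card_mx.
rewrite -(on_card_preimset (onW_bij _ (f2mx_bij W U))).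
rewrite -(on_card_preimset (onW_bij _ (v2r_bij U))).
rewrite -(bij_eq_card (f2mx_bij W U)) => cardB.
apply: etrans (etrans _ cardB) _; congr (_ * _)%N; apply: eq_card => x.
  by rewrite !inE; apply/asboolP/idP=> /eventually_zero_nilpmx.
by rewrite !inE lfun_mulmx -[LHS](inj_eq (can_inj r2vK)) linear0.
Qed.

(** Evaluation at a nonzero y is linear and onto, so all its fibres are translates of its kernel. *)
Lemma card_lfun_eval (y : U) : y != 0 ->
  (#|[set g : finvect_type 'Hom(U, W) | (g : 'Hom(U, W)) y == 0%R]| * #|finvect_type W|
    = #|finvect_type 'Hom(U, W)|)%N.
Proof.
move=> y0; have freey : row_free (v2r y).
  rewrite /row_free rank_rV -[0]r2vK (inj_eq (can_inj v2rK)) linear0.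
  by rewrite y0.
have evalP w : exists g : 'Hom(U, W), g y = w.
  (* A nonzero row is row free, so its pseudo-inverse is a right inverse. *)
  exists (Hom (pinvmx (v2r y) *m v2r w)).
  by rewrite lfun_mulmx /= mulmxA mulmxVp // mul1mx v2rK.
rewrite -[RHS]sum1_card (partition_big (fun g : finvect_type 'Hom(U, W) =>
  (g : 'Hom(U, W)) y : finvect_type W) xpredT) //=.
rewrite mulnC -sum_nat_const; apply: eq_bigr => w _; rewrite sum1dep_card.
have [h hy] := evalP w.
rewrite -[LHS](card_imset _ (@addrI (finvect_type 'Hom(U, W)) h)).
apply: eq_card => g; rewrite [RHS]inE; apply/imsetP/eqP => [[g']|gy].
  by rewrite inE => /eqP gy' ->; rewrite add_lfunE hy gy' addr0.
exists (g - h : 'Hom(U, W)); last by rewrite addrC subrK.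
by rewrite inE add_lfunE opp_lfunE gy hy subrr.
Qed.

(** The factor [y != 0] makes the count valid for every y, so that it can be summed over all y. *)
Lemma card_lfun_eval_neq0 (y : U) :
  (#|[set g : finvect_type 'Hom(U, W) | (g : 'Hom(U, W)) y != 0%R]| * #|finvect_type W|
    = #|finvect_type 'Hom(U, W)| * ((y != 0%R) * #|finvect_type W|.-1))%N.
Proof.
have [->|y0] := eqVneq y 0.
  rewrite muln0 (eq_card0 (A := mem [set g | _])) // => g.
  by rewrite inE linear0 eqxx.
have W_gt0 : (0 < #|finvect_type W|)%N by apply/card_gt0P; exists 0.
have := cardsC [set g : finvect_type 'Hom(U, W) | (g : 'Hom(U, W)) y == 0].
rewrite (_ : ~: _ = [set g : finvect_type 'Hom(U, W) | (g : 'Hom(U, W)) y != 0]);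
  last by apply/setP=> g; rewrite !inE.
move: (card_lfun_eval y0); case: #|finvect_type W| W_gt0 => //= w _.
move: #|_| #|_| #|_| => a b h; rewrite !mulnS mul1n => <- /eqP.
by rewrite eqn_add2l => /eqP ->; rewrite mulnDl addnC.
Qed.

End LinearMaps.

(** * Resampling one coordinate of a uniform family *)

Section Resampling.
Variables (I : finType) (T : I -> finType).

Definition upd (f : {dffun forall i, T i}) i (x : T i) : {dffun forall i, T i} :=
  [ffun j => dfwith f x j].

Lemma upd_in f i (x : T i) : upd f x i = x.
Proof. by rewrite ffunE dfwith_in. Qed.

Lemma upd_out f i (x : T i) j : i != j -> upd f x j = f j.
Proof. by move=> nij; rewrite ffunE dfwith_out. Qed.

(** Exchanging x with the coordinate f i is an involution on the pairs (f, x). *)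
Lemma sum_upd i (phi : {dffun forall i, T i} -> nat) :
  (\sum_f \sum_(x : T i) phi (upd f x) = #|T i| * \sum_f phi f)%N.
Proof.
pose swap (p : {dffun forall i, T i} * T i) := (upd p.1 p.2, p.1 i).
have swapK : involutive swap.
  move=> [f x]; rewrite /swap /= upd_in; congr (_, _).
  apply/ffunP=> j; have [<-|nij] := eqVneq i j; first by rewrite upd_in.
  by rewrite !upd_out.
rewrite pair_bigA /= (reindex_inj (inv_inj swapK)) /=.
rewrite -(pair_bigA _ (fun f x => phi (upd (upd f x) (f i)))) /= big_distrr /=.
apply: eq_bigr => f _; rewrite -sum_nat_const; apply: eq_bigr => x _.
by rewrite -[upd _ _]/(swap (swap (f, x))).1 swapK.
Qed.

End Resampling.

(** * Composites along the cycle *)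

Section Paths.
Variables (F : finFieldType) (k : nat) (V : 'I_k -> vectType F).
Implicit Types (f : Rep V) (i : 'I_k) (s : {i : 'I_k & V i}).

Lemma val_iter_ordS l i : iter l (@ordS k) i = ((i + l) %% k)%N :> nat.
Proof.
elim: l => [|l IHl]; first by rewrite addn0 modn_small.
by rewrite iterS /= IHl -addn1 modnDml addn1 addnS.
Qed.

Lemma iter_ordS_inj i l m : (l < k)%N -> (m < k)%N ->
  iter l (@ordS k) i = iter m (@ordS k) i -> l = m.
Proof.
move=> lt_l lt_m /(congr1 val); rewrite /= !val_iter_ordS => /eqP.
by rewrite eqn_modDl !modn_small // => /eqP.
Qed.

Lemma iter_ordS_surj i j : exists2 a, (a < k)%N & iter a (@ordS k) i = j.
Proof.
exists ((j + (k - i)) %% k)%N; first by rewrite ltn_pmod // (leq_trans _ (ltn_ord i)).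
apply: val_inj; rewrite /= val_iter_ordS modnDmr addnCA subnKC 1?ltnW //.
by rewrite modnDr modn_small.
Qed.

Lemma prod_iter_ordS (c : 'I_k -> nat) i :
  (\prod_(l < k) c (iter l (@ordS k) i) = \prod_j c j)%N.
Proof.
rewrite [RHS](reindex_inj (h := fun l : 'I_k => iter l (@ordS k) i)) // => l m.
by move/iter_ordS_inj => eq_lm; apply: val_inj; apply: eq_lm.
Qed.

(* Points of the total space are moved along the arrows without any cast
   between [V (iter k ordS i)] and [V i]. *)
Definition step f s : {i : 'I_k & V i} := Tagged V (arrow f (tag s) (tagged s)).

Lemma iter_step f i (x : V i) l :
  iter l (step f) (Tagged V x) = Tagged V (path_comp f i l x).
Proof.
elim: l => [|l IHl]; first by rewrite /= id_lfunE.
by rewrite iterS IHl /step /= comp_lfunE.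
Qed.

Lemma tag_iter_step f s l : tag (iter l (step f) s) = iter l (@ordS k) (tag s).
Proof. by case: s => i x; rewrite iter_step. Qed.

Lemma iter_step_zero f s l : tagged s = 0 -> tagged (iter l (step f) s) = 0.
Proof. by case: s => i x /= ->; rewrite iter_step /= linear0. Qed.

Lemma path_comp_upd f i j (g : finvect_type 'Hom(V j, V (ordS j))) l :
  (forall m, (m < l)%N -> j != iter m (@ordS k) i) ->
  path_comp (upd f g) i l = path_comp f i l.
Proof.
elim: l => //= l IHl nj; rewrite IHl => [|m lt_m]; last by rewrite nj // ltnW.
by rewrite /arrow upd_out // nj.
Qed.

Definition cast_lfun i j (e : i = j) : 'Hom(V i, V j) :=
  let: erefl := e in \1%VF.

Lemma Tagged_cast i j (e : i = j) x : Tagged V (cast_lfun e x) = Tagged V x.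
Proof. by case: j / e; rewrite id_lfunE. Qed.

Lemma cast_lfun_eq0 i j (e : i = j) x : (cast_lfun e x == 0) = (x == 0).
Proof. by case: j / e; rewrite id_lfunE. Qed.

Section Return.
Variables (i : 'I_k) (e : iter k.-1 (@ordS k) (ordS i) = i).

(** The map B of the overview. Its path ends at a vertex only propositionally equal to i, hence the
    cast. *)
Definition return_map f : 'Hom(V (ordS i), V i) :=
  (cast_lfun e \o path_comp f (ordS i) k.-1)%VF.

(** The k - 1 arrows starting from i + 1 visit each arrow once except f_i. *)
Lemma return_map_upd f (g : finvect_type 'Hom(V i, V (ordS i))) :
  return_map (upd f g) = return_map f.
Proof.
rewrite /return_map path_comp_upd // => m lt_m; apply/eqP=> im.
have k_gt0 : (0 < k)%N by apply: leq_trans (ltn_ord i).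
suff km : k.-1 = m by rewrite km ltnn in lt_m.
by apply: iter_ordS_inj (etrans e im); lia.
Qed.

Lemma iter_loop f l (x : V (ordS i)) :
  iter (l * k) (step f) (Tagged V x)
    = Tagged V (iter l (fun y => arrow f i (return_map f y)) x).
Proof.
have k_gt0 : (0 < k)%N by apply: leq_trans (ltn_ord i).
elim: l => // l IHl; rewrite mulSn iterD IHl.
have -> s : iter k (step f) s = step f (iter k.-1 (step f) s).
  by rewrite -iterS prednK.
by rewrite iter_step -(Tagged_cast e) /step /= comp_lfunE.
Qed.

(** Every long path reaches i + 1 and then makes many full turns, each of which applies f_i B. *)
Lemma nilpotent_repP f :
  nilpotent_rep f <-> eventually_zero (fun x => arrow f i (return_map f x)).
Proof.
have k_gt0 : (0 < k)%N by apply: leq_trans (ltn_ord i).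
split=> [/(_ (ordS i))[L L0]|[L L0] j].
  exists L => x; have := iter_loop f L x.
  rewrite iter_step L0 ?leq_pmulr // zero_lfunE.
  by move/(congr1 (fun s => tagged s == 0)) => /=; rewrite eqxx => /esym/eqP.
have [a _ ja] := iter_ordS_surj j (ordS i).
(* The a steps lead from j to i + 1, L turns give zero, and zero persists afterwards. *)
exists (L * k + a)%N => l le_l; apply/lfunP=> x; rewrite zero_lfunE.
suff: tagged (iter l (step f) (Tagged V x)) = 0 by rewrite iter_step.
rewrite -(subnK le_l) iterD; apply: iter_step_zero; rewrite iterD.
move: (tag_iter_step f (Tagged V x) a); rewrite ja.
case: (iter a _ _) => j' y /= ej; case: _ / (esym ej) y => y.
by rewrite iter_loop L0.
Qed.

End Return.

Local Notation c i := #|finvect_type (V i)|.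

Lemma card_finvect_gt0 i : (0 < c i)%N.
Proof. by apply/card_gt0P; exists 0. Qed.

(** With denominators cleared: for uniform f and x the composite is nonzero at x with probability
    the product of 1 - 1/|V_j| over the l + 1 vertices visited. Since l < k, the last arrow is
    independent of the earlier ones. *)
Lemma sum_path_comp_neq0 i l : (l < k)%N ->
  ((\sum_(f : Rep V) #|[set x : finvect_type (V i) | path_comp f i l x != 0%R]|)
     * \prod_(m < l) c (iter m.+1 (@ordS k) i)
   = #|Rep V| * \prod_(m < l.+1) (c (iter m (@ordS k) i)).-1)%N.
Proof.
elim: l => [|l IHl] lt_l.
  rewrite big_ord0 muln1 big_ord_recl big_ord0 muln1 -sum_nat_const.
  apply: eq_bigr => f _; rewrite -(cardC1 (0 : finvect_type (V i))).
  by apply: eq_card => x; rewrite !inE id_lfunE.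
rewrite big_ord_recr [in RHS]big_ord_recr /= [in RHS]mulnA -(IHl (ltnW lt_l)).
set j := iter l _ i; set S := (\sum_(f : Rep V) _)%N.
set S' := (\sum_(f : Rep V) _)%N.
suff eqS : (S' * c (ordS j) = S * (c (ordS j)).-1)%N.
  by rewrite mulnA mulnAC eqS mulnAC.
have h_gt0 : (0 < #|finvect_type 'Hom(V j, V (ordS j))|)%N by apply/card_gt0P; exists 0.
(* Multiplying by the number of choices for the arrow at j allows it to be resampled with the rest
   of the path fixed. *)
apply/eqP; rewrite -(eqn_pmul2l h_gt0) mulnA -(sum_upd j) /=; apply/eqP.
rewrite !big_distrl big_distrr /=; apply: eq_bigr => f _.
have path_upd (g : finvect_type 'Hom(V j, V (ordS j))) x :
    path_comp (upd f g) i l.+1 x = (g : 'Hom(V j, V (ordS j))) (path_comp f i l x).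
  rewrite /= comp_lfunE path_comp_upd ?/arrow ?upd_in // => m lt_m.
  by apply/eqP=> /iter_ordS_inj; lia.
under eq_bigr => g _ do rewrite card_set_sum.
rewrite exchange_big /= card_set_sum !big_distrl big_distrr /=.
apply: eq_bigr => x _; rewrite -card_lfun_eval_neq0 card_set_sum; congr (_ * _)%N.
by apply: eq_bigr => g _; rewrite path_upd.
Qed.

(** Resampling f_i leaves B fixed, so [card_eventually_zero] applies for each B. *)
Lemma card_nilpotent_reps_return i (e : iter k.-1 (@ordS k) (ordS i) = i) :
  (#|nilpotent_reps V| * c (ordS i)
    = \sum_(f : Rep V) #|[set x : finvect_type (V (ordS i)) | return_map e f x == 0%R]|)%N.
Proof.
have h_gt0 : (0 < #|finvect_type 'Hom(V i, V (ordS i))|)%N by apply/card_gt0P; exists 0.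
apply/eqP; rewrite -(eqn_pmul2l h_gt0) mulnA card_set_sum -(sum_upd i); apply/eqP.
rewrite big_distrl big_distrr; apply: eq_bigr => f _ /=.
rewrite -card_eventually_zero card_set_sum; congr (_ * _)%N.
apply: eq_bigr => g _; congr (nat_of_bool _).
apply: asbool_equiv_eq; rewrite (nilpotent_repP e) return_map_upd.
by rewrite /arrow upd_in.
Qed.

(** The vectors x with B x = 0 give the nilpotent term, those with B x nonzero give the other one;
    the path of B visits every vertex once. *)
Lemma card_nilpotent_reps : (0 < k)%N ->
  (#|nilpotent_reps V| * \prod_i c i + #|Rep V| * \prod_i (c i).-1
    = #|Rep V| * \prod_i c i)%N.
Proof.
move=> k_gt0; pose i := Ordinal k_gt0; set i1 := ordS i.
have e : iter k.-1 (@ordS k) i1 = i.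
  by rewrite -iterSr prednK //; apply: val_inj; rewrite /= val_iter_ordS modnDr modn_small.
have lt_k : (k.-1 < k)%N by rewrite ltn_predL.
have := sum_path_comp_neq0 i1 lt_k.
rewrite (prednK k_gt0) (prod_iter_ordS (fun i => (c i).-1)) => <-.
have recl (d : nat -> nat) : (\prod_(l < k) d l = d 0 * \prod_(l < k.-1) d l.+1)%N.
  by rewrite -(big_mkord xpredT d) big_ltn // big_add1 big_mkord.
rewrite -(prod_iter_ordS (fun i => c i) i1) (recl (fun l => c (iter l _ i1))).
rewrite [iter 0 _ _]/=.
rewrite !mulnA (card_nilpotent_reps_return e) -mulnDl -big_split -sum_nat_const /=.
congr (_ * _)%N; apply: eq_bigr => f _.
rewrite -[RHS](cardsC [set x : finvect_type (V i1) | return_map e f x == 0]).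
congr (_ + _)%N; apply: eq_card => x.
by rewrite !inE /return_map comp_lfunE cast_lfun_eq0.
Qed.

(** The complement is the product of the sets of nonzero vectors. *)
Lemma card_zero_tuples :
  (#|zero_tuples V| + \prod_i (c i).-1 = \prod_i c i)%N.
Proof.
have foldr_prod (s : 'I_k -> nat) : foldr muln 1%N [seq s i | i : 'I_k] = (\prod_i s i)%N.
  by rewrite foldrE big_map big_enum.
have <- : #|tuples V| = (\prod_i c i)%N by rewrite card_dep_ffun foldr_prod.
pose vT i : finType := finvect_type (V i).
have := @card_family _ vT (fun i => predC1 (0 : finvect_type (V i))).
rewrite foldr_prod (eq_bigr (fun i => (c i).-1)) => [<-|i _]; last exact: cardC1.
rewrite -(cardsC (zero_tuples V)); congr (_ + _)%N; apply: eq_card => v.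
rewrite !inE negb_exists; apply/familyP/forallP => v0 i; have := v0 i;
  by rewrite !inE.
Qed.

End Paths.

(** * The probability of nilpotency *)

Theorem proposition3p13 (k : nat) (hk : (2 <= k)%N)
    (F : finFieldType) (q : nat) (hq : #|F| = q)
    (beta : 'I_k -> nat) (V : 'I_k -> vectType F)
    (hV : forall i : 'I_k, \dim {:V i} = beta i) :
  Prob (nilpotent_reps V)
    = #|zero_tuples V|%:R / (\prod_(i < k) #|finvect_type (V i)|)%:R
  /\ #|zero_tuples V|%:R / (\prod_(i < k) #|finvect_type (V i)|)%:R
    = 1 - \prod_(i < k) (1 - (q%:R ^- beta i)) :> rat.
Proof.
set c := fun i => #|finvect_type (V i)|.
have c_neq0 i : (c i)%:R != 0 :> rat by rewrite pnatr_eq0 -lt0n card_finvect_gt0.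
have prod_neq0 : (\prod_i c i)%:R != 0 :> rat.
  by rewrite natr_prod; apply/prodf_neq0 => i _; apply: c_neq0.
have rep_neq0 : #|Rep V|%:R != 0 :> rat.
  by rewrite pnatr_eq0 -lt0n; apply/card_gt0P; exists [ffun i => 0].
have cardN := card_nilpotent_reps V (ltnW hk).
have cardZ := card_zero_tuples V.
split.
  rewrite /Prob; apply/eqP; rewrite eqr_div // -!natrM eqr_nat; apply/eqP.
  (* Multiplying [cardZ] by |Rep| and comparing with [cardN] cancels the common term with the (c
     i).-1. *)
  rewrite [RHS]mulnC; move: cardN; rewrite -[in RHS]cardZ mulnDr.
  by move/eqP; rewrite eqn_add2r => /eqP.
have -> : \prod_(i < k) (1 - q%:R ^- beta i)
    = (\prod_i (c i).-1)%:R / (\prod_i c i)%:R :> rat.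
  rewrite !natr_prod -prodf_div; apply: eq_bigr => i _.
  have -> : q%:R ^+ beta i = (c i)%:R :> rat.
    by rewrite -natrX -hq -hV dimvf -card_finvect.
  have c_gt0 : (0 < c i)%N by apply: card_finvect_gt0.
  by rewrite -[X in (X.-1)%:R]/(c i) -subn1 natrB // mulrBl divff // mul1r.
by rewrite -[X in X - _](divff prod_neq0) -mulrBl -cardZ natrD addrK.
Qed.
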